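(* Let $0\le t\le\lfloor m/2\rfloor$. The weights of the codewords $c_B$ ($B\neq0$) of the code $C_{symm}(2t,m)$ are exactly $$W_{2\ell+1}(2t,m)=\frac{q-1}{q}\sum_{s=0}^{2t}\mu_s(m)-\frac{q-1}{q}q^{2t}F_t^{(m-1)}(\ell)\qquad(0\le\ell,\ 2\ell+1\le m)$$ and $$W_{2\ell}^{\tau}(2t,m)=\frac{q-1}{q}\sum_{s=0}^{2t}\mu_s(m)-\frac{q-1}{q}q^{2t}F_t^{(m-1)}(\ell-1)\qquad(1\le\ell,\ 2\ell\le m,\ \tau\in\{1,-1\}).$$
   Context: $m$ is a positive integer, $q$ is a power of an odd prime, $\mathbb{F}_q$ is the finite field with $q$ elements, and $\mathbb{X}$ is the space of $m\times m$ symmetric matrices over $\mathbb{F}_q$. $\mu_r(m)$ is the number of matrices in $\mathbb{X}$ of rank $r$. For $0\le a\le m$ write $\{A\in\mathbb{X}:\operatorname{rank}(A)\le a\}=\{A_1,\dots,A_N\}$; the code $C_{symm}(a,m)\subseteq\mathbb{F}_q^N$ consists of the codewords $c_B=(\mathrm{Tr}(BA_1),\dots,\mathrm{Tr}(BA_N))$, $B\in\mathbb{X}$. Types: a symmetric matrix of odd rank has type $0$. A symmetric matrix of even rank $2s$ has type $1$ (hyperbolic) if the nondegenerate quadratic form it induces modulo its radical is hyperbolic (an orthogonal sum of $s$ hyperbolic planes), and type $-1$ (elliptic) otherwise. Weights: for $B\in\mathbb{X}$ of rank $k$ and type $\tau$, $W_k^{\tau}(a,m)$ denotes the Hamming weight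 of $c_B\in C_{symm}(a,m)$, i.e. $|\{A\in\mathbb{X}:\operatorname{rank}(A)\le a,\ \mathrm{Tr}(BA)\ne0\}|$; it depends only on $k,\tau$ (and $a,m,q$), not on $B$. When $k$ is odd, $\tau$ is omitted. Generalized Krawtchouk polynomials: for an integer $M\ge0$ put $n=\lfloor M/2\rfloor$, and for $0\le s\le n$ let $\Omega_s$ be the set of $M\times M$ skew-symmetric matrices over $\mathbb{F}_q$ of rank $2s$. Fix a nontrivial character $\chi$ of $(\mathbb{F}_q,+)$. For $0\le s\le n$ and any $A=(a_{ij})\in\Omega_s$, $$F_r^{(M)}(s)=\sum_{B=(b_{ij})\in\Omega_r}\chi\Big(\sum_{i<j}a_{ij}b_{ij}\Big),$$ which is independent of the choices of $A$ and $\chi$; $F_r^{(M)}(s)=0$ if $r<0$ or $r>n$. (It is known that for $n\ge1$ and $0\le r\le n$, $F_r^{(M)}(s)=\sum_{j=0}^r(-1)^{r-j}q^{(r-j)(r-j-1)}\left[{n-j\atop n-r}\right]\left[{n-s\atop j}\right]c^j$ with $c=q^{M(M-1)/(2n)}$ and $\left[{a\atop k}\right]=\prod_{i=0}^{k-1}\frac{q^{2a}-q^{2i}}{q^{2k}-q^{2i}}$.) *)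

(* Defs.v *)
From mathcomp Require Export all_boot all_order all_fingroup all_algebra.
From mathcomp Require Export all_solvable all_field all_character.

Set Implicit Arguments.
Unset Strict Implicit.
Unset Printing Implicit Defensive.

Import Order.TTheory GRing.Theory Num.Theory.
Local Open Scope ring_scope.

Section SymmetricMatrixCodes.

Variable F : finFieldType.

Definition symm (m : nat) : {set 'M[F]_m} := [set A | A \is symmetricmx].

Definition mu (r m : nat) : nat := #|[set A in symm m | \rank A == r]|.

Definition symm_rank_le (a m : nat) : {set 'M[F]_m} :=
  [set A in symm m | (\rank A <= a)%N].

(* The codeword c_B of C_symm(a, m); A_1, ..., A_N is the library's enumeration
   of symm_rank_le a m. *)
Definition codeword (a m : nat) (B : 'M[F]_m) : 'rV[F]_#|symm_rank_le a m| :=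
  \row_i \tr (B *m enum_val i).

Definition hamming_weight (N : nat) (c : 'rV[F]_N) : nat :=
  #|[set i | c 0 i != 0]|.

(* The form induced by u *m B *m v^T on row vectors modulo its radical kermx B
   is an orthogonal sum of s hyperbolic planes: the rows e_i of E and f_i of G
   are lifts of vectors that span the quotient and satisfy (e_i, e_j) = 0,
   (f_i, f_j) = 0 and (e_i, f_j) = 1 if i = j, 0 otherwise, where
   s = \rank B / 2.  Such lifts are automatically independent modulo kermx B. *)
Definition hyperbolic (m : nat) (B : 'M[F]_m) : bool :=
  [exists E : 'M[F]_((\rank B)./2, m), exists G : 'M[F]_((\rank B)./2, m),
    [&& ~~ odd (\rank B),
        E *m B *m E^T == 0,
        G *m B *m G^T == 0,
        E *m B *m G^T == 1%:M
      & (E + G + kermx B == 1%:M)%MS]].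

Definition qtype (m : nat) (B : 'M[F]_m) : int :=
  if odd (\rank B) then 0 else if hyperbolic B then 1 else -1.

(* W_k^tau(a, m) = w: matrices of rank k and type tau exist, and the codeword of
   each of them has weight w. *)
Definition is_weight (a m k : nat) (tau : int) (w : algC) : Prop :=
  (exists B : 'M[F]_m, [/\ B \in symm m, \rank B = k & qtype B = tau]) /\
  (forall B : 'M[F]_m, B \in symm m -> \rank B = k -> qtype B = tau ->
     (hamming_weight (codeword a B))%:R = w).

(* The set Omega_s of skew-symmetric matrices of rank 2s; in odd characteristic
   skewmx forces a zero diagonal. *)
Definition Omega (M s : nat) : {set 'M[F]_M} :=
  [set A | (A \is skewmx) && (\rank A == 2 * s)%N].

(* F_r^(M)(s) is krawtchouk chi r A for any nontrivial additive character chi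
   and any A in Omega M s; it is 0 if r > M./2, since Omega M r is then empty. *)
Definition krawtchouk (chi : 'CF([set: F])) (M r : nat) (A : 'M[F]_M) : algC :=
  \sum_(B in Omega M r)
    chi (\sum_(i < M) \sum_(j < M | (i < j)%N) A i j * B i j).

End SymmetricMatrixCodes.

(* Main.v *)
Require Import Defs.
From mathcomp Require Import ring zify.

Set Implicit Arguments.
Unset Strict Implicit.
Unset Printing Implicit Defensive.

Import Order.TTheory GRing.Theory Num.Theory.
Local Open Scope ring_scope.

(** Why the theorem holds.  Fix a nontrivial additive character psi of F_q and
    put S_t(B) = sum of psi(Tr(BA)) over the symmetric A of rank at most 2t.
    Since this set of A is stable under multiplication by nonzero scalars,
    orthogonality of characters counts the zeros of the codeword of B in terms
    of S_t(B), and the weight is (q - 1)/q (N - S_t(B)), where N is the length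
    of the code ([weight_psi]).  The theorem is therefore the identity
    [symm_fourier_eq_alt_fourier]: for symmetric B <> 0 of size n + 1 and an
    alternating C of size n with rank C = 2 floor((rank B - 1) / 2),

      S_t(B) = q^(2t) K_t(C),   K_t(C) = sum of psi(Tr(CA)) over alternating A
                                of rank 2t.

    Both sides are Fourier transforms of functions of the rank, and they obey
    the same recursion.  To see it, write a matrix with A^T = eps A, eps = 1 or
    -1, as a bordered matrix [[a, x], [eps x^T, A']].  If x = yA' is in the row
    space of A', its rank is rank A' or rank A' + 1 according to whether
    a = yA'y^T; otherwise its rank is rank A' + 2.  Pairing it with
    [[0, b], [eps b^T, B']] and summing over a and x leaves character sums over
    the row space of A', which vanish unless A'b^T = 0.  Two choices of b
    matter:

    - b = 0 ([fourier_radical]): a vector of the radical of B is split off;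
    - b = (1, 0, ..., 0) with B' = 0 + B'' ([fourier_hyperbolic]): a hyperbolic
      plane is split off, and only the matrices A' = 0 + A'' contribute.

    The resulting recursions for S_t in size n + 1 and for q^(2t) K_t in size n
    coincide.  A degenerate B lets both sides lose a radical vector; a
    nondegenerate B of size at least 3 has an isotropic vector
    ([isotropic_exists]), so both sides lose a hyperbolic plane.  For
    nondegenerate B of size at most 2 and t > 0, every A has rank at most 2t,
    so S_t(B) = 0, and K_t(C) is an empty sum.  The recursion sees B only
    through its rank, which is why the weight does not depend on the type.

    The type matters only for the existence of matrices of each rank and type:
    a nondegenerate form of rank 2l is hyperbolic only if its determinant is a
    square times that of the standard hyperbolic form, and a diagonal matrix can
    be given a determinant that violates this. *)

(** * Bordered matrices and congruence *)

Section BorderedMatrices.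

Variables (F : finFieldType) (e : F).
Hypothesis e2 : e * e = 1.

Lemma eps_neq0 : e != 0.
Proof. by apply: contra_eq_neq e2 => ->; rewrite mul0r eq_sym oner_eq0. Qed.

(** Symmetric matrices (e = 1) and alternating ones (e = -1, in odd
    characteristic) are treated together. *)
Definition eps_symm n (A : 'M[F]_n) : bool := A^T == e *: A.

Lemma eps_symm_congr n (P A : 'M[F]_n) :
  eps_symm A -> eps_symm (P *m A *m P^T).
Proof.
move=> /eqP hA; apply/eqP.
by rewrite !trmx_mul trmxK hA -scalemxAl -scalemxAr mulmxA.
Qed.

Definition bordered n (a : F) (x : 'rV[F]_n) (A : 'M[F]_n) : 'M[F]_(1 + n) :=
  block_mx a%:M x (e *: x^T) A.

Lemma eps_symm_bordered n a (x : 'rV[F]_n) A :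
  eps_symm (bordered a x A) = (a == e * a) && eps_symm A.
Proof.
rewrite /eps_symm /bordered tr_block_mx scale_block_mx tr_scalar_mx linearZ /= trmxK.
rewrite scalerA e2 scale1r scale_scalar_mx.
apply/eqP/andP => [/eq_block_mx[ha _ _ ->]|[/eqP ha /eqP->]]; last by rewrite -ha.
by split=> //; move/matrixP/(_ 0 0): ha; rewrite !mxE /= !mulr1n => /eqP.
Qed.

Lemma bordered_surj n (M : 'M[F]_(1 + n)) : eps_symm M ->
  M = bordered (M 0 0) (ursubmx M) (drsubmx M).
Proof.
move/eqP=> hM; rewrite -{1}(submxK M) /bordered; congr block_mx.
  by apply/matrixP=> i j; rewrite !ord1 !mxE /= mulr1n; congr (M _ _); apply: val_inj.
have -> : (ursubmx M)^T = e *: dlsubmx M.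
  by rewrite trmx_ursub hM; apply/matrixP=> i j; rewrite !mxE.
by rewrite scalerA e2 scale1r.
Qed.

Lemma rank_col_mx_row m n (x : 'rV[F]_n) (M : 'M[F]_(m, n)) :
  \rank (col_mx x M) = (\rank M + ~~ (x <= M)%MS)%N.
Proof.
rewrite -addsmxE; case: (boolP (x <= M)%MS) => [xM|xM] /=.
  rewrite addn0; apply: (eqmx_rank (_ : (x + M == M)%MS)).
  by rewrite addsmxSr addsmx_sub xM submx_refl.
have x0 : x != 0 by apply: contraNneq xM => ->; rewrite sub0mx.
have cap0 : \rank (x :&: M)%MS = 0%N.
  apply/eqP; rewrite -leqn0 -ltnS; apply: contraNT xM; rewrite -leqNgt => h.
  apply: submx_trans (capmxSr x M).
  by rewrite -(geq_leqif (mxrank_leqif_sup (capmxSl x M))) rank_rV x0.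
by have := mxrank_sum_cap x M; rewrite cap0 addn0 rank_rV x0 addnC.
Qed.

Lemma rank_row_mx_col m n (x : 'cV[F]_m) (M : 'M[F]_(m, n)) :
  \rank (row_mx x M) = (\rank M + ~~ (x^T <= M^T)%MS)%N.
Proof. by rewrite -mxrank_tr tr_row_mx rank_col_mx_row mxrank_tr. Qed.

(** The column e x^T is A y^T, so the lower block row has the rank of A; the
    first row is a combination of the lower ones exactly when its corner is the
    value of the form A at y. *)
Lemma rank_bordered_in n a (y : 'rV[F]_n) (A : 'M[F]_n) : eps_symm A ->
  \rank (bordered a (y *m A) A) = (\rank A + (a != (y *m A *m y^T) 0 0)%R)%N.
Proof.
move=> /eqP hA; rewrite /bordered.
set x := y *m A.
have hx : e *: x^T = A *m y^T by rewrite /x trmx_mul hA -scalemxAl scalerA e2 scale1r.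
rewrite -[block_mx _ _ _ _]/(col_mx _ _) rank_col_mx_row rank_row_mx_col hx.
have -> : ((A *m y^T)^T <= A^T)%MS by rewrite trmx_mul trmxK submxMl.
rewrite addn0; congr (_ + nat_of_bool _)%N; congr negb.
apply/submxP/eqP => [[u]|->].
  rewrite mul_mx_row => /eq_row_mx[ha hxu].
  have -> : a = (a%:M : 'M_1) 0 0 by rewrite mxE eqxx mulr1n.
  by rewrite ha mulmxA -hxu.
exists y; rewrite mul_mx_row mulmxA; congr row_mx.
by rewrite [RHS]mx11_scalar.
Qed.

(** By symmetry both the new column and the new row are independent of the old
    ones. *)
Lemma rank_bordered_out n a (x : 'rV[F]_n) (A : 'M[F]_n) : eps_symm A ->
  ~~ (x <= A)%MS -> \rank (bordered a x A) = (\rank A).+2.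
Proof.
move=> /eqP hA xA; rewrite /bordered.
rewrite -[block_mx _ _ _ _]/(col_mx _ _) rank_col_mx_row rank_row_mx_col.
have -> : ((e *: x^T)^T <= A^T)%MS = false.
  by rewrite linearZ /= trmxK hA !eqmx_scale ?eps_neq0 // (negPf xA).
suff -> : (row_mx a%:M x <= row_mx (e *: x^T) A)%MS = false by rewrite !addn1.
apply/negP => /submxP[u]; rewrite mul_mx_row => /eq_row_mx[_ xu].
by rewrite xu submxMl in xA.
Qed.

Lemma rank_bordered0 n (A : 'M[F]_n) : eps_symm A ->
  \rank (bordered 0 0 A) = \rank A.
Proof.
move=> hA; rewrite -(mul0mx 1 A) rank_bordered_in //.
by rewrite !mul0mx mxE eqxx addn0.
Qed.

Lemma row0_eq0_bordered n (M : 'M[F]_(1 + n)) : eps_symm M -> row 0 M = 0 ->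
  exists2 A : 'M[F]_n, eps_symm A & M = bordered 0 0 A.
Proof.
move=> hM M0; have eM := bordered_surj hM; exists (drsubmx M).
  by move: hM; rewrite {1}eM eps_symm_bordered; case/andP.
have M00 : M 0 0 = 0 by move/rowP/(_ 0): M0; rewrite !mxE.
have Mu : ursubmx M = 0.
  apply/rowP=> j; move/rowP/(_ (rshift 1 j)): M0; rewrite !mxE => <-.
  by congr (M _ _); apply: val_inj.
by rewrite eM M00 Mu block_mxKdr.
Qed.

Lemma first_row_unit n (v : 'rV[F]_n.+1) : v != 0 ->
  {P : 'M[F]_n.+1 | P \in unitmx & row 0 P = v}.
Proof.
move=> v0.
pose f : 'M[F]_n.+1 := \matrix_i v.
have hf : (delta_mx 0 0 : 'rV[F]_n.+1) *m f = v by rewrite -rowE rowK.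
have [|g gu] := @complete_unitmx _ _ _ (delta_mx 0 0 : 'rV[F]_n.+1) f.
  by rewrite hf !rank_rV v0 -rank_rV mxrank_delta.
by rewrite hf -rowE => ->; exists g.
Qed.

Lemma rank_congr n (P A : 'M[F]_n) : P \in unitmx ->
  \rank (P *m A *m P^T) = \rank A.
Proof.
move=> Pu; rewrite mxrankMfree ?row_free_unit ?unitmx_tr //.
by rewrite -mxrank_tr trmx_mul mxrankMfree ?row_free_unit ?unitmx_tr // mxrank_tr.
Qed.

(** A radical vector completed to a basis. *)
Lemma congr_radical n (B : 'M[F]_n.+1) : eps_symm B -> (\rank B < n.+1)%N ->
  exists P (B' : 'M[F]_n), [/\ P \in unitmx, eps_symm B', \rank B' = \rank B
    & P *m B *m P^T = bordered 0 0 B'].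
Proof.
move=> hB rB.
have [v v0 vB] : exists2 v : 'rV[F]_n.+1, v != 0 & v *m B = 0.
  have /rowV0Pn[v vk v0] : kermx B != 0.
    by rewrite -mxrank_eq0 mxrank_ker -lt0n subn_gt0.
  by exists v => //; apply/sub_kermxP.
have [P Pu Pv] := first_row_unit v0.
have hC := eps_symm_congr P hB.
have C0 : row 0 (P *m B *m P^T) = 0 by rewrite !row_mul Pv vB mul0mx.
have rC := rank_congr B Pu.
have [B' hB' eB'] := @row0_eq0_bordered n _ hC C0.
exists P, B'; split=> //.
by rewrite -rC eB' rank_bordered0.
Qed.

Hypothesis two_neq0 : (2 : F) != 0.

Definition e1 n : 'rV[F]_(1 + n) := row_mx 1%:M 0.

Lemma e1_delta n : e1 n = delta_mx 0 0 :> 'rV_n.+1.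
Proof.
apply/rowP=> j; case: (@split_ordP 1 n j) => k ->.
  transitivity ((1%:M : 'M[F]_1) 0 k); first exact: row_mxEl.
  by rewrite !mxE !ord1 !eqxx.
transitivity ((0 : 'rV[F]_n) 0 k); first exact: row_mxEr.
by rewrite !mxE.
Qed.

(** The change of basis that fixes the first vector, acts by g on the others and
    adds to them the multiples c of the first one. *)
Lemma bordered_congr n (x : 'rV[F]_n) (A g : 'M[F]_n) (c : 'cV[F]_n) :
  let Q := block_mx (1%:M : 'M_1) 0 c g in
  Q *m bordered 0 x A *m Q^T =
  bordered 0 (x *m g^T)
    (e *: (g *m x^T *m c^T) + c *m (x *m g^T) + g *m A *m g^T).
Proof.
have z : (0 : F)%:M = 0 :> 'M_1 by exact: raddf0.
rewrite /= /bordered z tr_block_mx !trmx1 !trmx0 !mulmx_block.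
rewrite !(mul1mx, mulmx1, mul0mx, mulmx0, addr0, add0r).
rewrite trmx_mul trmxK -scalemxAr -scalemxAl.
by rewrite mulmxDl -mulmxA addrA.
Qed.

(** An isotropic vector outside the radical lies in a hyperbolic plane, which
    splits off.  The form is first given the border (0, 1, 0, ..., 0) by a change
    of basis of the last n + 1 vectors; multiples of the first vector are then
    added to the others to clear the remaining row. *)
Lemma congr_hyperbolic n (B : 'M[F]_n.+2) (v : 'rV_n.+2) : eps_symm B ->
  v *m B *m v^T = 0 -> v *m B != 0 ->
  exists P (B' : 'M[F]_n), [/\ P \in unitmx, eps_symm B', \rank B = (\rank B').+2
    & P *m B *m P^T = bordered 0 (e1 n) (bordered 0 0 B')].
Proof.
move=> hB vBv vB.
have v0 : v != 0 by apply: contraNneq vB => ->; rewrite mul0mx.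
have [P Pu Pv] := first_row_unit v0.
have hC := eps_symm_congr P hB.
have C0 : row 0 (P *m B *m P^T) = v *m B *m P^T by rewrite !row_mul Pv.
have rC := rank_congr B Pu.
have C0n : v *m B *m P^T != 0.
  apply: contraNneq vB => h; apply/eqP.
  by rewrite -[LHS](mulmxK (_ : P^T \in unitmx)) ?unitmx_tr // h mul0mx.
have C00 : (P *m B *m P^T) 0 0 = 0.
  have := congr1 (fun M : 'rV_n.+2 => M 0 0) C0; rewrite mxE => ->.
  suff -> : (v *m B *m P^T) 0 0 = (v *m B *m v^T) 0 0 by rewrite vBv mxE.
  rewrite !mxE; apply: eq_bigr => j _; congr (_ * _).
  by rewrite -Pv !mxE.
have [C CE] : exists C : 'M_(1 + n.+1), C = P *m B *m P^T by exists (P *m B *m P^T).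
rewrite -CE in hC C00 rC C0; rewrite -C0 in C0n.
have eC := bordered_surj hC; rewrite C00 in eC.
set b := ursubmx C in eC; set B1 := drsubmx C in eC.
have b0 : b != 0.
  apply: contraNneq C0n => hb; apply/eqP/rowP=> j.
  rewrite [LHS]mxE [RHS]mxE; case: (@split_ordP 1 n.+1 j) => k ->.
    by rewrite -[RHS]C00 ord1; congr (C _ _); apply: val_inj.
  move/rowP/(_ k): hb; rewrite /b !mxE => <-.
  by congr (C _ _); apply: val_inj.
have hB1 : eps_symm B1.
  by move: hC; rewrite {1}eC eps_symm_bordered; case/andP.
have [h hu hb] := first_row_unit b0.
pose g := (invmx h)^T.
have bg : b *m g^T = e1 n.
  by rewrite trmxK e1_delta -hb rowE mulmxK.
have [D DE] : exists D : 'M_(1 + n), D = g *m B1 *m g^T by eexists.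
have hD : eps_symm D by rewrite DE; apply: eps_symm_congr.
pose d := row 0 D.
have d0 : e * d 0 0 = d 0 0.
  by move/eqP/matrixP/(_ 0 0): hD; rewrite !mxE => <-.
(* The new first row of the lower block is e c^T + c_0 e_1 + d, where c^T = ct
   has first entry c_0; as e d_0 = d_0, the choice below makes it vanish. *)
pose ct : 'rV_(1 + n) := - (e *: (d - (d 0 0 / 2) *: e1 n)).
pose Q := block_mx (1%:M : 'M_1) 0 ct^T g.
have Qu : Q \in unitmx.
  by rewrite unitmxE det_lblock det1 mul1r -unitmxE unitmx_tr unitmx_inv.
exists (Q *m P).
have QPE : Q *m P *m B *m (Q *m P)^T =
    bordered 0 (e1 n) (e *: (ct^T *m e1 n)^T + ct^T *m e1 n + D).
  rewrite trmx_mul !mulmxA -(mulmxA Q) -(mulmxA Q) -CE eC bordered_congr bg DE.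
  by rewrite -bg !trmx_mul !trmxK.
have rQP := rank_congr B (_ : Q *m P \in unitmx).
have QPu : Q *m P \in unitmx by rewrite unitmx_mul Qu.
have := eps_symm_congr (Q *m P) hB; have {rQP} := rQP QPu; rewrite {}QPE.
have [E EE] : exists E, E = e *: (ct^T *m e1 n)^T + ct^T *m e1 n + D by eexists.
rewrite -EE => rE; rewrite eps_symm_bordered => /andP[_ hE].
have e100 : e1 n 0 0 = 1 by rewrite e1_delta mxE !eqxx.
have ctE j : ct 0 j = - (e * (d 0 j - d 0 0 / 2 * e1 n 0 j)).
  by rewrite /ct; move: (e1 n) => f; rewrite !mxE.
have hh : d 0 0 / 2 + d 0 0 / 2 = d 0 0 by field.
have ct0 : ct 0 0 = - (d 0 0 / 2).
  by rewrite ctE e100 mulr1 mulrBr mulrA d0 -{1}hh addrK.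
have E0 : row 0 E = 0.
  apply/rowP=> j.
  have -> : row 0 E 0 j = e * (ct 0 j * e1 n 0 0) + ct 0 0 * e1 n 0 j + d 0 j.
    by rewrite EE /d; move: (e1 n) => f; rewrite !mxE !big_ord1 !mxE.
  by rewrite e100 ct0 ctE mulr1 mulrN mulrA e2 !mxE; ring.
have [B' hB' eB'] := row0_eq0_bordered hE E0.
exists B'; split=> //; last by rewrite -eB'.
rewrite -rE rank_bordered_out //; first by rewrite eB' rank_bordered0.
apply/negP => /submxP[u /matrixP/(_ 0 0)]; rewrite e100 mxE big1.
  by move/eqP; rewrite oner_eq0.
move=> i _; move/eqP/matrixP/(_ 0 i): hE; rewrite !mxE => ->.
by move/rowP/(_ i): E0; rewrite !mxE => ->; rewrite !mulr0.
Qed.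

End BorderedMatrices.

(** * Quadratic forms over a finite field of odd order *)

Section OddFiniteFields.

Variable F : finFieldType.
Hypothesis oddF : odd #|F|.

(** If 2 = 0, then 1 has order 2 in the additive group of F. *)
Lemma odd_card_two_neq0 : (2 : F) != 0.
Proof.
apply/negP => /eqP two0.
have d2 : (#[(1 : F)%R]%g %| 2)%N by rewrite order_dvdn FinRing.zmodXgE two0.
have dF : (#[(1 : F)%R]%g %| #|F|)%N by rewrite -cardsT order_dvdG ?inE.
have /primeP[_ /(_ _ d2)] : prime 2 by [].
case/orP=> /eqP o1; last by have := dvdn_odd dF oddF; rewrite o1.
by move/eqP: o1; rewrite order_eq1 => /eqP/eqP; rewrite oner_eq0.
Qed.

(** The fibres have at most two elements, and the inequality is strict because
    #|F| is odd. *)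
Lemma card_image_two_to_one (f : F -> F) :
  (forall x y, f x = f y -> x = y \/ x = - y) ->
  (#|F| < 2 * #|[set f x | x : F]|)%N.
Proof.
move=> hf.
have h : (#|F| <= 2 * #|[set f x | x : F]|)%N.
  rewrite mulnC -sum_nat_const -sum1_card (partition_big_imset f) /=.
  apply: leq_sum => z /imsetP[x _ ->].
  rewrite sum1_card; apply: leq_trans (subset_leq_card (_ : _ \subset [set x; - x])) _.
    apply/subsetP=> y; by rewrite !inE => /eqP/hf[]->; rewrite eqxx ?orbT.
  by rewrite cards2; case: eqP.
move: h; rewrite leq_eqVlt => /predU1P[h|//]; move: oddF.
by rewrite h mul2n odd_double.
Qed.

(** Pigeonhole: the values of a x^2 and those of c - b y^2 each fill more than
    half of F, so some value is common. *)
Lemma binary_form_represents (a b c : F) : a != 0 -> b != 0 ->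
  exists x y, a * x ^+ 2 + b * y ^+ 2 = c.
Proof.
move=> a0 b0.
have sqr_inj (d k : F) : d != 0 -> forall x y,
  k + d * x ^+ 2 = k + d * y ^+ 2 -> x = y \/ x = - y.
  move=> d0 x y /addrI /(mulfI d0) /eqP; rewrite eqf_sqr => /orP[]/eqP; by [left|right].
have hA := card_image_two_to_one (sqr_inj a 0 a0).
have hB : - b != 0 by rewrite oppr_eq0.
have {}hB := card_image_two_to_one (sqr_inj (- b) c hB).
set A := [set _ | _ in _] in hA; set B := [set _ | _ in _] in hB.
have /pred0Pn[z /andP[/imsetP[x _ zx] /imsetP[y _ zy]]] : ~~ [disjoint A & B].
  apply/negP => dAB; have : (#|A :|: B| <= #|F|)%N by exact: max_card.
  by rewrite cardsU disjoint_setI0 // cards0; lia.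
exists x, y; have := zx; rewrite zy add0r => <-; ring.
Qed.

(** Squaring identifies 1 and -1, so it is not injective, hence not surjective. *)
Lemma nonsquare_exists : exists z : F, forall x, x ^+ 2 != z.
Proof.
case: (pickP (fun z : F => [forall x, x ^+ 2 != z])) => [z /forallP|h].
  by move=> hz; exists z.
have himg : [set x ^+ 2 | x : F] = setT.
  apply/setP=> z; rewrite inE; have /forallPn[x] := negbT (h z).
  by rewrite negbK => /eqP <-; apply/imsetP; exists x.
have /imset_injP/(_ 1 (-1)) : #|[set x ^+ 2 | x : F]| == #|F| by rewrite himg cardsT.
rewrite sqrrN => /(_ isT isT erefl) /eqP.
by rewrite -subr_eq0 opprK (negPf odd_card_two_neq0).
Qed.

(** Successive kernels give three nonzero, pairwise orthogonal vectors u1, u2, u3.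
    If none of them is isotropic, some x u1 + y u2 + u3 is, and it is nonzero
    because it is not orthogonal to u3. *)
Lemma isotropic_exists n (B : 'M[F]_n.+3) : B^T = B ->
  exists2 v : 'rV_n.+3, v != 0 & v *m B *m v^T = 0.
Proof.
move=> hB.
have ker m (M : 'M[F]_(n.+3, m)) :
    (m < n.+3)%N -> exists2 u : 'rV_n.+3, u != 0 & u *m M = 0.
  move=> hm; have /rowV0Pn[u uk u0] : kermx M != 0.
    rewrite -mxrank_eq0 mxrank_ker -lt0n subn_gt0.
    by apply: leq_ltn_trans (rank_leq_col M) hm.
  by exists u => //; apply/sub_kermxP.
have sym (u w : 'rV_n.+3) : w *m B *m u^T = u *m B *m w^T.
  by rewrite [LHS]mx11_scalar -tr_scalar_mx -mx11_scalar !trmx_mul trmxK hB mulmxA.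
have q0 (u : 'rV_n.+3) : u != 0 -> (u *m B *m u^T) 0 0 = 0 ->
    exists2 v : 'rV_n.+3, v != 0 & v *m B *m v^T = 0.
  by move=> u0 qu; exists u; rewrite // [LHS]mx11_scalar qu; apply: raddf0.
have [u1 u10 _] := ker 0%N 0 isT.
have [|a0] := eqVneq ((u1 *m B *m u1^T) 0 0) 0; first exact: q0.
have [u2 u20 u21] := ker _ (B *m u1^T) isT; rewrite mulmxA in u21.
have [|b0] := eqVneq ((u2 *m B *m u2^T) 0 0) 0; first exact: q0.
have [u3 u30 u312] := ker _ (row_mx (B *m u1^T) (B *m u2^T)) isT.
move: u312; rewrite mul_mx_row !mulmxA -row_mx0 => /eq_row_mx[u31 u32].
have [|c0] := eqVneq ((u3 *m B *m u3^T) 0 0) 0; first exact: q0.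
have [x [y xy]] := binary_form_represents (- (u3 *m B *m u3^T) 0 0) a0 b0.
pose v := x *: u1 + y *: u2 + u3.
have u12 : u1 *m B *m u2^T = 0 by rewrite sym.
have u13 : u1 *m B *m u3^T = 0 by rewrite sym.
have u23 : u2 *m B *m u3^T = 0 by rewrite sym.
apply: (q0 v).
  apply: contraNneq c0 => v0.
  have : v *m B *m u3^T = u3 *m B *m u3^T.
    by rewrite /v !mulmxDl -!scalemxAl u13 u23 !scaler0 !add0r.
  by rewrite v0 !mul0mx => <-; rewrite mxE.
have -> : v^T = x *: u1^T + y *: u2^T + u3^T by rewrite !linearD /= !linearZ.
rewrite /v !mulmxDl !mulmxDr -!scalemxAl -!scalemxAr.
rewrite u21 u31 u32 u12 u13 u23 !scaler0 !addr0 !add0r.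
move: xy; move: (u1 *m B *m u1^T) (u2 *m B *m u2^T) (u3 *m B *m u3^T) => a b c xy.
by rewrite !mxE -[c 0 0]opprK -xy; ring.
Qed.

End OddFiniteFields.

(** * Fourier transforms of functions of the rank *)

Section CharacterSums.

Variables (F : finFieldType) (psi : F -> algC).
Hypothesis psiD : forall x y, psi (x + y) = psi x * psi y.
Hypothesis psi0 : psi 0 = 1.
Hypothesis psi_nontrivial : exists c, psi c != 1.
Hypothesis two_neq0 : (2 : F) != 0.

Local Notation q := (#|F|%:R : algC).

Lemma psi_scaled_neq1 d : d != 0 -> exists c, psi (c * d) != 1.
Proof.
by case: psi_nontrivial => c hc d0; exists (c / d); rewrite divfK.
Qed.

(** Translating the index by d multiplies the sum by psi (f d) <> 1. *)
Lemma sum_psi_translation_eq0 (V : finZmodType) (P : pred V) (f : V -> F) d :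
  (forall v, f (v + d) = f v + f d) -> (forall v, P (v + d) = P v) ->
  psi (f d) != 1 -> \sum_(v | P v) psi (f v) = 0.
Proof.
move=> fD PD hd; set S := LHS.
have : S = psi (f d) * S.
  rewrite {1}/S (reindex_inj (addIr d)) /= big_distrr /=.
  by apply: eq_big => [v|v _]; rewrite ?PD // fD psiD mulrC.
move/eqP; rewrite -subr_eq0 -{1}[S]mul1r -mulrBl mulf_eq0 subr_eq0 eq_sym.
by rewrite (negPf hd) => /eqP.
Qed.

Lemma sum_rowspace n (A : 'M[F]_n) (b : 'cV[F]_n) :
  \sum_(x : 'rV[F]_n | (x <= A)%MS) psi ((x *m b) 0 0) =
    (A *m b == 0)%:R * q ^+ \rank A.
Proof.
have [Ab|Ab] := eqVneq (A *m b) 0.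
  rewrite mul1r -natrX -card_rowg -sum1_card natr_sum.
  apply: eq_big => [x|x /submxP[y ->]]; first by rewrite mem_rowg.
  by rewrite -mulmxA Ab mulmx0 mxE psi0.
rewrite mul0r.
have [i Abi] : exists i, (A *m b) i 0 != 0.
  apply/existsP; apply: contraNT Ab; rewrite negb_exists => /forallP h.
  by apply/eqP/colP=> i; rewrite [RHS]mxE; apply/eqP; move: (h i); rewrite negbK.
have [c hc] := psi_scaled_neq1 Abi.
have hA : (c *: row i A <= A)%MS by rewrite scalemx_sub // row_sub.
apply: (sum_psi_translation_eq0 (d := c *: row i A)) => [x|x|].
- by rewrite mulmxDl mxE.
- apply/idP/idP => [h|h]; last by rewrite addmx_sub.
  by rewrite -[x](addrK (c *: row i A)) addmx_sub // eqmx_opp.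
- by rewrite -scalemxAl mxE -row_mul mxE.
Qed.

(** The Fourier transform, at B, of the function w o rank on the space of
    matrices with A^T = e A. *)
Definition rank_fourier e n (w : nat -> algC) (B : 'M[F]_n) : algC :=
  \sum_(A : 'M[F]_n | eps_symm e A) w (\rank A) * psi (\tr (B *m A)).

Lemma eq_fourier e n w w' (B : 'M[F]_n) :
  w =1 w' -> rank_fourier e w B = rank_fourier e w' B.
Proof. by move=> h; apply: eq_bigr => A _; rewrite h. Qed.

Lemma fourier_linear e n a b w w' (B : 'M[F]_n) :
  rank_fourier e (fun r => a * w r + b * w' r) B =
  a * rank_fourier e w B + b * rank_fourier e w' B.
Proof.
rewrite /rank_fourier !big_distrr /= -big_split /=; apply: eq_bigr => A _.
by rewrite mulrDl !mulrA.
Qed.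

Section Sign.

Variable e : F.
Hypothesis e2 : e * e = 1.

Lemma fourier_congr n w (P B : 'M[F]_n) : P \in unitmx ->
  rank_fourier e w (P *m B *m P^T) = rank_fourier e w B.
Proof.
move=> Pu; rewrite /rank_fourier [RHS](reindex_onto (fun A => P^T *m A *m P)
  (fun A => invmx P^T *m A *m invmx P)) /=; last first.
  by move=> A _; rewrite -!mulmxA mulVmx // mulmx1 mulKVmx ?unitmx_tr.
apply: eq_big => [A|A _].
  rewrite -!mulmxA mulmxV // mulmx1 mulKmx ?unitmx_tr // eqxx andbT mulmxA.
  apply/idP/idP => h; first by rewrite -{2}(trmxK P); apply: eps_symm_congr.
  have := eps_symm_congr (invmx P^T) h; rewrite -trmx_inv trmxK trmx_inv.
  by rewrite -!mulmxA mulmxV // mulmx1 mulKmx ?unitmx_tr.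
have -> : \rank (P^T *m A *m P) = \rank A.
  by rewrite -{2}(trmxK P) rank_congr ?unitmx_tr.
congr (_ * psi _).
by rewrite -2!mulmxA mxtrace_mulC !mulmxA.
Qed.

Lemma big_bordered n (f : 'M[F]_(1 + n) -> algC) :
  \sum_(M | eps_symm e M) f M =
  \sum_(A | eps_symm e A) \sum_x \sum_(a | a == e * a) f (bordered e a x A).
Proof.
under [RHS]eq_bigr => A _ do rewrite pair_big_dep /=.
rewrite pair_big_dep /=.
rewrite (reindex_onto (fun p : 'M[F]_n * ('rV[F]_n * F) => bordered e p.2.2 p.2.1 p.1)
  (fun M => (drsubmx M, (ursubmx M, M 0 0)))) /=; last first.
  by move=> M hM; rewrite -bordered_surj.
apply: eq_bigl => -[A [x a]] /=; rewrite eps_symm_bordered //.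
rewrite block_mxKdr block_mxKur.
have -> : bordered e a x A 0 0 = a.
  transitivity ((a%:M : 'M_1) 0 0); last by rewrite mxE mulr1n.
  by rewrite -(block_mxEul _ x (e *: x^T) A 0 0); congr (_ _ _); apply: val_inj.
by rewrite eqxx andbT andbC.
Qed.

(** The number of possible corners of a bordered matrix: #|F| for symmetric
    matrices and 1 for alternating ones. *)
Definition corner_count : nat := #|[pred a | a == e * a]|.

Local Notation N := (corner_count%:R : algC).

(** When x = yA, exactly one admissible corner, the value yAy^T, keeps the
    rank. *)
Lemma sum_corner n w (x : 'rV[F]_n) A : eps_symm e A ->
  \sum_(a | a == e * a) w (\rank (bordered e a x A)) =
  if (x <= A)%MS then w (\rank A) + (N - 1) * w (\rank A).+1
  else N * w (\rank A).+2 :> algC.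
Proof.
move=> hA; case: ifPn => [/submxP[y ->]|xA]; last first.
  under eq_bigr => a _ do rewrite rank_bordered_out //.
  by rewrite sumr_const mulr_natl.
set a0 := (y *m A *m y^T) 0 0.
have ha0 : a0 == e * a0.
  have /eqP h := hA.
  have /(congr1 (fun M : 'M_1 => M 0 0)) : (y *m A *m y^T)^T = e *: (y *m A *m y^T).
    by rewrite !trmx_mul trmxK h -scalemxAl -scalemxAr mulmxA.
  by rewrite [LHS]mxE [RHS]mxE => ha; apply/eqP.
rewrite (bigD1 a0) //= rank_bordered_in // eqxx addn0; congr (_ + _).
under eq_bigr => a /andP[_ ha] do rewrite rank_bordered_in // ha addn1.
rewrite sumr_const -[LHS]mulr_natl; congr (_ * _).
rewrite /corner_count [in RHS](cardD1 a0) [a0 \in _]ha0 natrD.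
rewrite addrAC subrr add0r; congr _%:R.
by apply: eq_card => a; rewrite !inE andbC.
Qed.

Lemma trace_bordered n (B' : 'M[F]_n) (be x : 'rV[F]_n) a A :
  \tr (bordered e 0 be B' *m bordered e a x A) =
  (x *m (2 * e *: be^T)) 0 0 + \tr (B' *m A).
Proof.
rewrite /bordered mulmx_block mxtrace_block !raddfD /= -!scalemxAl -!scalemxAr !linearZ /=.
rewrite (raddf0 (@scalar_mx F 1)) mul0mx raddf0 add0r addrA; congr (_ + _).
rewrite [\tr (be^T *m x)]mxtrace_mulC -[\tr (be *m x^T)]mxtrace_tr trmx_mul trmxK.
by rewrite -mulrDl mxE trace_mx11; ring.
Qed.

(** Summing over the corner first leaves the sums of psi (2 e x b^T) over the
    x in the row space of A, which is q^(rank A) if A b^T = 0 and 0 otherwise,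
    and over all x, which is q^n if b = 0 and 0 otherwise. *)
Lemma fourier_bordered n w (be : 'rV[F]_n) (B : 'M[F]_n) :
  rank_fourier e w (bordered e 0 be B) =
  \sum_(A | eps_symm e A) psi (\tr (B *m A)) *
    ((A *m be^T == 0)%:R * q ^+ \rank A *
        (w (\rank A) + (N - 1) * w (\rank A).+1 - N * w (\rank A).+2)
      + (be == 0)%:R * (N * q ^+ n * w (\rank A).+2)).
Proof.
have te0 : 2 * e != 0 by rewrite mulf_neq0 // eps_neq0.
rewrite /rank_fourier big_bordered; apply: eq_bigr => A hA.
set b := 2 * e *: be^T.
have bA : (A *m b == 0) = (A *m be^T == 0) by rewrite -scalemxAr scaler_eq0 (negPf te0).
have b1 : (1%:M *m b == 0) = (be == 0).
  by rewrite mul1mx scaler_eq0 (negPf te0) trmx_eq0.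
pose g (x : 'rV_n) := psi ((x *m b) 0 0).
transitivity (psi (\tr (B *m A)) * \sum_x g x *
   \sum_(a | a == e * a) w (\rank (bordered e a x A))).
  rewrite big_distrr /=; apply: eq_bigr => x _; rewrite !big_distrr /=.
  by apply: eq_bigr => a _; rewrite trace_bordered // psiD /g; ring.
congr (_ * _).
under eq_bigr => x _ do rewrite sum_corner //.
have hin : \sum_(x | (x <= A)%MS) g x = (A *m be^T == 0)%:R * q ^+ \rank A.
  by rewrite sum_rowspace bA.
have hall : \sum_x g x = (be == 0)%:R * q ^+ n.
  have := sum_rowspace 1%:M b; rewrite b1 mxrank1 => <-.
  by apply: eq_bigl => x; rewrite submx1.
rewrite (bigID (fun x => (x <= A)%MS)) /= in hall.
rewrite (bigID (fun x => (x <= A)%MS)) /=.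
under eq_bigr => x xA do rewrite xA.
under [X in _ + X]eq_bigr => x xA do rewrite (negPf xA).
rewrite -!big_distrl /= -hin.
have -> : (be == 0)%:R * (N * q ^+ n * w (\rank A).+2) =
  N * ((be == 0)%:R * q ^+ n) * w (\rank A).+2 by ring.
by rewrite -hall; ring.
Qed.

Lemma fourier_radical n w (B : 'M[F]_n) :
  rank_fourier e w (bordered e 0 0 B) =
  rank_fourier e (fun r => q ^+ r * (w r + (N - 1) * w r.+1 - N * w r.+2)
         + N * q ^+ n * w r.+2) B.
Proof.
rewrite fourier_bordered; apply: eq_bigr => A _.
by rewrite trmx0 mulmx0 !eqxx !mul1r mulrC.
Qed.

(** Here the first border is nonzero, so only the A annihilating the first basis
    vector contribute, and these are bordered by zeros. *)
Lemma fourier_hyperbolic n w (B : 'M[F]_n) :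
  rank_fourier e w (bordered e 0 (e1 F n) (bordered e 0 0 B)) =
  rank_fourier e (fun r => q ^+ r * (w r + (N - 1) * w r.+1 - N * w r.+2)) B.
Proof.
rewrite fourier_bordered big_bordered; apply: eq_bigr => A hA.
have e1n0 : (e1 F n == 0) = false.
  by apply/eqP => /rowP/(_ 0) /eqP; rewrite e1_delta !mxE !eqxx oner_eq0.
have e1bord a x : (bordered e a x A *m (e1 F n)^T == 0) = (a == 0) && (x == 0).
  rewrite /bordered /e1 tr_row_mx mul_block_col trmx1 trmx0 !mulmx1 !mulmx0 !addr0.
  rewrite col_mx_eq0 scaler_eq0 trmx_eq0 -[e == 0]negbK eps_neq0 //; congr (_ && _).
  apply/eqP/eqP=> [/matrixP/(_ 0 0)|->]; last exact: raddf0.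
  by rewrite !mxE mulr1n.
rewrite (bigD1 (0 : 'rV[F]_n)) //= [X in _ + X]big1 ?addr0 => [|x /negPf x0]; last first.
  by rewrite big1 // => a _; rewrite e1bord x0 andbF e1n0 !mul0r addr0 mulr0.
rewrite (bigD1 (0 : F)) ?mulr0 //=.
rewrite [X in _ + X]big1 ?addr0 => [|a /andP[_ /negPf a0]]; last first.
  by rewrite e1bord a0 e1n0 !mul0r addr0 mulr0.
rewrite e1bord !eqxx e1n0 mul0r addr0 mul1r rank_bordered0 // mulrC.
by rewrite trace_bordered mul0mx mxE add0r.
Qed.

End Sign.
End CharacterSums.

(** * Symmetric transforms in size n + 1 and alternating transforms in size n *)

Section MainIdentity.

Variables (F : finFieldType) (psi : F -> algC).
Hypothesis psiD : forall x y, psi (x + y) = psi x * psi y.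
Hypothesis psi0 : psi 0 = 1.
Hypothesis psi_nontrivial : exists c, psi c != 1.
Hypothesis oddF : odd #|F|.

Local Notation q := (#|F|%:R : algC).
Local Notation fourier := (rank_fourier psi).

Let two_neq0 : (2 : F) != 0 := odd_card_two_neq0 oddF.

Definition at_most (k r : nat) : algC := (r <= k)%:R.
Definition exactly (k r : nat) : algC := (r == k)%:R.

(** Nondegeneracy of the trace form on symmetric matrices: if B_ij <> 0, the
    matrix E_ij + E_ji pairs with B to 2 B_ij <> 0. *)
Lemma sum_symm_zero n (B : 'M[F]_n) : eps_symm 1 B -> B != 0 ->
  \sum_(A | eps_symm 1 A) psi (\tr (B *m A)) = 0.
Proof.
move=> /eqP hB; rewrite scale1r in hB => B0.
have [[i j] /= Bij] : exists p : 'I_n * 'I_n, B p.1 p.2 != 0.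
  apply/existsP; apply: contraNT B0; rewrite negb_exists => /forallP h.
  apply/eqP/matrixP=> i j; rewrite [RHS]mxE; apply/eqP.
  by move: (h (i, j)); rewrite negbK.
have trB (k l : 'I_n) : \tr (B *m delta_mx k l) = B l k.
  rewrite /mxtrace (bigD1 l) //= big1 => [|m /negPf ml]; rewrite mxE (bigD1 k) //= big1.
  - by rewrite mxE !eqxx mulr1 !addr0.
  - by move=> p /negPf pk; rewrite mxE pk mulr0.
  - by rewrite mxE ml andbF mulr0 addr0.
  - by move=> p /negPf pk; rewrite mxE pk mulr0.
have [c hc] := psi_scaled_neq1 psi_nontrivial (mulf_neq0 two_neq0 Bij).
pose D : 'M_n := c *: (delta_mx i j + delta_mx j i).
have hD : eps_symm 1 D.
  by rewrite /eps_symm scale1r /D linearZ /= linearD /= !trmx_delta addrC.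
have trD : \tr (B *m D) = c * (2 * B i j).
  rewrite /D -scalemxAr linearZ /= mulmxDr linearD /= !trB.
  have -> : B j i = B i j by rewrite -{1}hB mxE.
  by ring.
rewrite -trD in hc.
apply: (sum_psi_translation_eq0 psiD (f := fun A => \tr (B *m A)) _ _ hc).
  by move=> A; rewrite mulmxDr linearD.
move=> A; move: hD; rewrite /eps_symm !scale1r linearD /= => /eqP ->.
by rewrite (inj_eq (addIr D)).
Qed.

Lemma corner_count1 : corner_count (1 : F) = #|F|.
Proof. by apply: eq_card => a; rewrite !inE mul1r eqxx. Qed.

Lemma corner_countN1 : corner_count (-1 : F) = 1%N.
Proof.
rewrite /corner_count (@eq_card1 _ 0) // => a.
rewrite !inE mulN1r -subr_eq0 opprK -mulr2n.
by rewrite -mulr_natl mulf_eq0 (negPf two_neq0).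
Qed.

Lemma fourier_rank0 e n w (B : 'M[F]_n) : w 0%N = 1 -> (forall r, w r.+1 = 0) ->
  fourier e w B = 1.
Proof.
move=> w0 wS; rewrite /rank_fourier (bigD1 0) /=; last by rewrite /eps_symm trmx0 scaler0.
rewrite mxrank0 w0 mulmx0 mxtrace0 psi0 mul1r big1 ?addr0 // => A /andP[_ A0].
by move: A0; rewrite -mxrank_eq0; case: (\rank A) => // r _; rewrite wS mul0r.
Qed.

(** The weight that [fourier_hyperbolic] produces from the indicator of the ranks
    at most t + 2: for r <= t the terms cancel, and for r = t + 1 the bracket is
    q, which completes q^r to q^(t + 2). *)
Lemma at_most_step (t r : nat) (q : algC) :
  q ^+ r * ((r <= t.+2)%:R + (q - 1) * (r < t.+2)%:R - q * (r.+1 < t.+2)%:R) =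
  q ^+ t.+2 * ((r <= t.+2)%:R - (r <= t)%:R).
Proof.
rewrite !ltnS; have [h|h] := leqP r t.
  by rewrite (leqW h) (leqW (leqW h)) /=; ring.
have [h1|h1] := leqP r t.+1.
  have -> : r = t.+1 by lia.
  by rewrite leqnSn !exprS /=; ring.
have [h2|h2] := leqP r t.+2; last by rewrite /=; ring.
have -> : r = t.+2 by lia.
by rewrite /=; ring.
Qed.

Lemma exactly_step (t r : nat) (q : algC) :
  q ^+ r * ((r == t.+2)%:R - (r == t)%:R) =
  q ^+ t.+2 * (r == t.+2)%:R - q ^+ t * (r == t)%:R.
Proof.
have [->|h] := eqVneq r t.
  by rewrite (_ : (t == t.+2) = false) /=; [ring|lia].
by have [->|h1] := eqVneq r t.+2; rewrite /=; ring.
Qed.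

Lemma symm_fourier_radical n t (B : 'M[F]_n) :
  fourier 1 (at_most t.+1.*2) (bordered 1 0 0 B) =
  q ^+ t.+1.*2 * fourier 1 (at_most t.+1.*2) B
    + (q ^+ n.+1 - q ^+ t.+1.*2) * fourier 1 (at_most t.*2) B.
Proof.
rewrite fourier_radical ?mulr1 // corner_count1 -fourier_linear.
apply: eq_fourier => r.
by rewrite /at_most doubleS at_most_step !ltnS -exprS; ring.
Qed.

Lemma symm_fourier_hyperbolic n t (B : 'M[F]_n) :
  fourier 1 (at_most t.+1.*2) (bordered 1 0 (e1 F n) (bordered 1 0 0 B)) =
  q ^+ t.+1.*2 * fourier 1 (at_most t.+1.*2) B - q ^+ t.+1.*2 * fourier 1 (at_most t.*2) B.
Proof.
rewrite fourier_hyperbolic ?mulr1 // corner_count1 -mulNr -fourier_linear.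
apply: eq_fourier => r.
by rewrite /at_most doubleS at_most_step; ring.
Qed.

Lemma alt_fourier_radical n t (C : 'M[F]_n) :
  fourier (-1) (exactly t.+1.*2) (bordered (-1) 0 0 C) =
  q ^+ t.+1.*2 * fourier (-1) (exactly t.+1.*2) C
    + (q ^+ n - q ^+ t.*2) * fourier (-1) (exactly t.*2) C.
Proof.
rewrite fourier_radical ?mulrNN ?mulr1 // corner_countN1 -fourier_linear.
apply: eq_fourier => r.
rewrite subrr mul0r addr0 mul1r /exactly doubleS !eqSS exactly_step; ring.
Qed.

Lemma alt_fourier_hyperbolic n t (C : 'M[F]_n) :
  fourier (-1) (exactly t.+1.*2) (bordered (-1) 0 (e1 F n) (bordered (-1) 0 0 C)) =
  q ^+ t.+1.*2 * fourier (-1) (exactly t.+1.*2) C - q ^+ t.*2 * fourier (-1) (exactly t.*2) C.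
Proof.
rewrite fourier_hyperbolic ?mulrNN ?mulr1 // corner_countN1 -mulNr -fourier_linear.
apply: eq_fourier => r.
rewrite subrr mul0r addr0 mul1r /exactly doubleS !eqSS exactly_step; ring.
Qed.

Lemma symm_fourier_full n k (B : 'M[F]_n) : eps_symm 1 B -> B != 0 -> (n <= k)%N ->
  fourier 1 (at_most k) B = 0.
Proof.
move=> hB B0 nk; rewrite -(sum_symm_zero hB B0); apply: eq_bigr => A _.
by rewrite /at_most (leq_trans (rank_leq_row A) nk) mul1r.
Qed.

Lemma fourier_empty e n k (C : 'M[F]_n) : (n < k)%N -> fourier e (exactly k) C = 0.
Proof.
move=> nk; apply: big1 => A _; rewrite /exactly (_ : (\rank A == k) = false) ?mul0r //.
by apply/negbTE; rewrite neq_ltn (leq_ltn_trans (rank_leq_row A) nk).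
Qed.

(** Induction on the size: both sides lose a radical vector if B is degenerate,
    a hyperbolic plane if B is nondegenerate of size at least 3.  The rank
    condition on C makes the same reduction available for C and is preserved
    by it. *)
Lemma symm_fourier_eq_alt_fourier n (B : 'M[F]_n.+1) (C : 'M[F]_n) t :
  eps_symm 1 B -> eps_symm (-1) C -> B != 0 ->
  \rank C = ((\rank B).-1)./2.*2 ->
  fourier 1 (at_most t.*2) B = q ^+ t.*2 * fourier (-1) (exactly t.*2) C.
Proof.
elim/ltn_ind: n B C t => n IH B C t hB hC B0 rC.
case: t => [|t]; first by rewrite !fourier_rank0 // mul1r.
have e2p : (1 : F) * 1 = 1 by rewrite mulr1.
have e2n : (-1 : F) * -1 = 1 by rewrite mulrNN mulr1.
have rB0 : (0 < \rank B)%N by rewrite lt0n mxrank_eq0.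
have [rB|] := ltnP (\rank B) n.+1.
  case: n IH B C hB hC B0 rC rB0 rB => [|n] IH B C hB hC B0 rC rB0 rB.
    by move: rB; rewrite ltnS leqn0 => /eqP rB; rewrite rB in rB0.
  have [P [B' [Pu hB' rB' PB]]] := congr_radical e2p hB rB.
  have rCn : (\rank C < n.+1)%N by rewrite rC; lia.
  have [Q [C' [Qu hC' rC' QC]]] := congr_radical e2n hC rCn.
  have B'0 : B' != 0 by rewrite -mxrank_eq0 rB' -lt0n.
  have rBC : \rank C' = ((\rank B').-1)./2.*2 by rewrite rB' rC'.
  rewrite -(fourier_congr psi _ _ _ Pu) PB -(fourier_congr psi _ _ _ Qu) QC.
  rewrite symm_fourier_radical alt_fourier_radical !(IH n _ B' C') //.
  by rewrite !doubleS !exprS; ring.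
move=> rB.
have {rB} rB : \rank B = n.+1 by apply/eqP; rewrite eqn_leq rank_leq_row.
case: n IH B C hB hC B0 rC rB0 rB => [|[|n]] IH B C hB hC B0 rC rB0 rB.
(* In sizes 1 and 2 all ranks are at most 2(t + 1), so the left-hand side is a
   complete character sum, while C is too small to have rank 2(t + 1). *)
1, 2: by rewrite symm_fourier_full // fourier_empty ?mulr0 //; lia.
have [v v0 vBv] : exists2 v : 'rV_n.+3, v != 0 & v *m B *m v^T = 0.
  by apply: isotropic_exists => //; move/eqP: hB; rewrite scale1r.
have vB : v *m B != 0.
  apply: contraNneq v0 => h.
  have Bu : B \in unitmx by rewrite -row_free_unit -row_leq_rank rB.
  by rewrite -[v](mulmxK Bu) h mul0mx.
have [P [B' [Pu hB' rB' PB]]] := congr_hyperbolic e2p two_neq0 hB vBv vB.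
have [u uC] : exists u : 'rV_n.+2, u *m C != 0.
  have /rowV0Pn[_ /submxP[u ->] uC] : C != 0 by rewrite -mxrank_eq0 rC rB; lia.
  by exists u.
have uCu : u *m C *m u^T = 0.
  apply/matrixP=> i j; rewrite !ord1 [RHS]mxE.
  have /(congr1 (fun M : 'M_1 => M 0 0)) : (u *m C *m u^T)^T = - (u *m C *m u^T).
    have /eqP := hC; rewrite scaleN1r => hC'.
    by rewrite !trmx_mul trmxK hC' mulNmx mulmxN mulmxA.
  rewrite mxE [RHS]mxE => /eqP; rewrite -subr_eq0 opprK -mulr2n -mulr_natl.
  by rewrite mulf_eq0 (negPf two_neq0) => /eqP.
have [Q [C' [Qu hC' rC' QC]]] := congr_hyperbolic e2n two_neq0 hC uCu uC.
have B'0 : B' != 0 by rewrite -mxrank_eq0; lia.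
have rBC : \rank C' = ((\rank B').-1)./2.*2 by lia.
rewrite -(fourier_congr psi _ _ _ Pu) PB -(fourier_congr psi _ _ _ Qu) QC.
rewrite symm_fourier_hyperbolic alt_fourier_hyperbolic !(IH n _ B' C') //.
by rewrite !doubleS !exprS; ring.
Qed.

End MainIdentity.

(** * Existence of matrices of each rank and type *)

Section Types.

Variable F : finFieldType.

(** The half rank, on which the types of E and G depend, is replaced by a given
    number. *)
Lemma hyperbolicP m l (B : 'M[F]_m) : \rank B = l.*2 ->
  reflect (exists E G : 'M[F]_(l, m),
    [/\ E *m B *m E^T = 0, G *m B *m G^T = 0, E *m B *m G^T = 1%:M
      & (E + G + kermx B == 1%:M)%MS]) (hyperbolic B).
Proof.
move=> rB; rewrite /hyperbolic.
have -> : odd (\rank B) = false by rewrite rB odd_double.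
have : (\rank B)./2 = l by rewrite rB doubleK.
move: (_./2) => l' el; subst l'.
apply: (iffP existsP) => [[E /existsP[G /and5P[_ /eqP ? /eqP ? /eqP ? ?]]]|].
  by exists E, G.
move=> [E [G [h1 h2 h3 h4]]]; exists E; apply/existsP; exists G.
by rewrite h1 h2 h3 h4 !eqxx.
Qed.

Definition padded l d (B0 : 'M[F]_l) : 'M[F]_(l + d) := block_mx B0 0 0 0.

Definition hyp_mx l : 'M[F]_(l + l) := block_mx 0 1%:M 1%:M 0.

Lemma hyp_mx_unit l : hyp_mx l \in unitmx.
Proof.
have : hyp_mx l *m hyp_mx l = 1%:M.
  rewrite mulmx_block !mul0mx !mulmx0 !mul1mx !addr0 !add0r.
  by rewrite -scalar_mx_block.
by case/mulmx1_unit.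
Qed.

Lemma rank_padded l d (B0 : 'M[F]_l) : \rank (padded d B0) = \rank B0.
Proof. by rewrite /padded rank_diag_block_mx mxrank0 addn0. Qed.

Lemma padded_symm l d (B0 : 'M[F]_l) : B0^T = B0 -> (padded d B0)^T = padded d B0.
Proof. by move=> h; rewrite /padded tr_block_mx h !trmx0. Qed.

Lemma padded_form l d k (B0 : 'M[F]_l) (X Y : 'M[F]_(k, l + d)) :
  X *m padded d B0 *m Y^T = lsubmx X *m B0 *m (lsubmx Y)^T.
Proof.
rewrite -{1}[X]hsubmxK -{1}[Y]hsubmxK tr_row_mx mul_row_block.
by rewrite !mulmx0 !addr0 mul_row_col mul0mx addr0.
Qed.

Lemma padded_hyp_mx l d : hyperbolic (padded d (hyp_mx l)).
Proof.
apply/(@hyperbolicP _ l).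
  by rewrite rank_padded mxrank_unit ?hyp_mx_unit // addnn.
exists (row_mx (row_mx 1%:M 0) 0), (row_mx (row_mx 0 1%:M) 0).
have k : (row_mx 0 1%:M <= kermx (padded d (hyp_mx l)))%MS.
  by apply/sub_kermxP; rewrite mul_row_block !mul0mx !mulmx0 !addr0 row_mx0.
have hX (X Y : 'M[F]_(l, l)) : row_mx X Y *m hyp_mx l = row_mx Y X.
  by rewrite mul_row_block !mulmx0 !mulmx1 addr0 add0r.
split.
1-3: rewrite padded_form !row_mxKl hX tr_row_mx mul_row_col trmx0 trmx1.
1-3: by rewrite !(mulmx0, mul0mx, mulmx1, addr0, add0r).
rewrite submx1 /=.
rewrite scalar_mx_block -[block_mx _ _ _ _]/(col_mx _ _) col_mx_sub.
rewrite (submx_trans k (addsmxSr _ _)) andbT.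
rewrite scalar_mx_block -[block_mx _ _ _ _]/(col_mx _ _) -[X in row_mx _ X]col_mx0.
rewrite -block_mxEh -[block_mx _ _ _ _]/(col_mx _ _) col_mx_sub.
apply/andP; split; apply: submx_trans (addsmxSl _ _); [exact: addsmxSl|exact: addsmxSr].
Qed.

(** The first coordinates of the rows of E and G form a matrix P with
    P B0 P^T = hyp_mx l; take determinants. *)
Lemma padded_hyperbolic_det l d (B0 : 'M[F]_(l + l)) : B0^T = B0 ->
  B0 \in unitmx -> hyperbolic (padded d B0) ->
  exists x, x ^+ 2 * \det B0 = \det (hyp_mx l).
Proof.
move=> hB Bu /(@hyperbolicP _ l) [|E [G [hE hG hEG _]]].
  by rewrite rank_padded mxrank_unit // addnn.
have hGE : G *m padded d B0 *m E^T = 1%:M.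
  by rewrite -[RHS]trmx1 -hEG !trmx_mul trmxK padded_symm // mulmxA.
exists (\det (col_mx (lsubmx E) (lsubmx G))).
rewrite expr2 mulrAC -{2}det_tr -!det_mulmx; congr (\det _).
rewrite tr_col_mx mul_col_mx mul_col_row -!padded_form.
by rewrite hE hG hEG hGE.
Qed.

(** A diagonal matrix whose determinant is a nonsquare times that of hyp_mx. *)
Lemma elliptic_mx l : odd #|F| -> exists B0 : 'M[F]_(l.+1 + l.+1),
  [/\ B0^T = B0, B0 \in unitmx & forall x, x ^+ 2 * \det B0 != \det (hyp_mx l.+1)].
Proof.
move=> oddF; have [nu hnu] := nonsquare_exists oddF.
have nu0 : nu != 0 by rewrite eq_sym; have := hnu 0; rewrite expr0n.
have dl0 : \det (hyp_mx l.+1) != 0 by rewrite -unitfE -unitmxE hyp_mx_unit.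
set dl := \det _ in dl0 *.
pose D : 'rV[F]_(l.+1 + l.+1) := \row_i if i == 0 then dl * nu else 1.
have dD : \det (diag_mx D) = dl * nu.
  rewrite det_diag (bigD1 0) //= mxE eqxx big1 ?mulr1 // => i /negPf i0.
  by rewrite mxE i0.
exists (diag_mx D); split; first exact: tr_diag_mx.
  by rewrite unitmxE dD unitfE mulf_neq0.
move=> x; rewrite dD; apply: contraNneq (hnu x^-1) => h.
have {}h : x ^+ 2 * nu = 1 by apply: (mulfI dl0); rewrite mulr1 -[RHS]h; ring.
have x20 : x ^+ 2 != 0 by apply: contra_eq_neq h => ->; rewrite mul0r eq_sym oner_eq0.
by rewrite exprVn; apply/eqP/(mulfI x20); rewrite h mulfV.
Qed.

Lemma symm_trmx m (B : 'M[F]_m) : (B \in symm F m) = eps_symm 1 B.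
Proof.
rewrite inE qualifE /= expr0 /eps_symm !scale1r eq_sym; congr (_ == _).
by apply/matrixP=> i j; rewrite !mxE.
Qed.

Lemma type_exists m l (tau : int) : odd #|F| -> (1 <= l)%N -> (l.*2 <= m)%N ->
  tau = 1 \/ tau = -1 ->
  exists B : 'M[F]_m, [/\ B \in symm F m, \rank B = l.*2 & qtype B = tau].
Proof.
move=> oddF; case: l => // l _ lm htau.
have [d ->] : exists d, m = (l.+1 + l.+1 + d)%N by exists (m - l.+1.*2)%N; lia.
have tq (B : 'M[F]_(l.+1 + l.+1 + d)) : \rank B = l.+1.*2 ->
    qtype B = if hyperbolic B then 1 else -1.
  by move=> h; rewrite /qtype h odd_double.
case: htau => ->.
  exists (padded d (hyp_mx l.+1)).
  have r : \rank (padded d (hyp_mx l.+1)) = l.+1.*2.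
    by rewrite rank_padded mxrank_unit ?hyp_mx_unit // addnn.
  split=> //; last by rewrite tq // padded_hyp_mx.
  by rewrite symm_trmx /eps_symm scale1r padded_symm // /hyp_mx tr_block_mx !trmx0 !trmx1.
have [B0 [hB Bu hd]] := elliptic_mx l oddF.
have r : \rank (padded d B0) = l.+1.*2 by rewrite rank_padded mxrank_unit // addnn.
exists (padded d B0); split=> //.
  by rewrite symm_trmx /eps_symm scale1r padded_symm.
rewrite tq //; case: ifPn => // /(padded_hyperbolic_det hB Bu)[x hx].
by have := hd x; rewrite hx eqxx.
Qed.

Lemma odd_rank_exists m l : (l.*2.+1 <= m)%N ->
  exists B : 'M[F]_m, [/\ B \in symm F m, \rank B = l.*2.+1 & qtype B = 0].
Proof.
move=> lm; exists (pid_mx l.*2.+1); have r := rank_pid_mx F lm lm.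
split=> //; last by rewrite /qtype r /= odd_double.
by rewrite symm_trmx /eps_symm scale1r tr_pid_mx.
Qed.

End Types.

(** * Weights of codewords *)

Section Weights.

Variables (F : finFieldType) (psi : F -> algC).
Hypothesis psiD : forall x y, psi (x + y) = psi x * psi y.
Hypothesis psi0 : psi 0 = 1.
Hypothesis psi_nontrivial : exists c, psi c != 1.
Hypothesis oddF : odd #|F|.

Local Notation q := (#|F|%:R : algC).
Local Notation fourier := (rank_fourier psi).

Lemma sum_psi_mul y : \sum_c psi (c * y) = (y == 0)%:R * q.
Proof.
have [->|y0] := eqVneq y 0.
  under eq_bigr => c _ do rewrite mulr0 psi0.
  by rewrite sumr_const mul1r.
have [c hc] := psi_scaled_neq1 psi_nontrivial y0.
rewrite mul0r; apply: (sum_psi_translation_eq0 psiD (f := *%R^~ y) _ _ hc) => //.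
by move=> x; rewrite mulrDl.
Qed.

Lemma in_symm_rank_le a m (A : 'M[F]_m) :
  (A \in symm_rank_le F a m) = eps_symm 1 A && (\rank A <= a)%N.
Proof. by rewrite inE symm_trmx. Qed.

Lemma fourier_symm_rank_le a m (B : 'M[F]_m) :
  fourier 1 (at_most a) B = \sum_(A in symm_rank_le F a m) psi (\tr (B *m A)).
Proof.
rewrite [RHS]big_mkcond [LHS]big_mkcond; apply: eq_bigr => A _.
rewrite in_symm_rank_le /at_most; case: (eps_symm 1 A) => //=.
by case: leq; rewrite ?mul1r ?mul0r.
Qed.

(** The number of zeros of the codeword is the average over c in F of the sums of
    psi (c Tr(BA)) over A.  The sum for c = 0 is the length, and for c <> 0 the
    bijection A |-> cA shows that it does not depend on c. *)
Lemma weight_psi a m (B : 'M[F]_m) :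
  (hamming_weight (codeword a B))%:R =
  (q - 1) / q * (#|symm_rank_le F a m|%:R - fourier 1 (at_most a) B) :> algC.
Proof.
set X := symm_rank_le F a m.
have q0 : q != 0 by rewrite pnatr_eq0 -lt0n; apply/card_gt0P; exists 0.
have hw : (hamming_weight (codeword a B))%:R =
    \sum_(A in X) (1 - (\tr (B *m A) == 0)%:R) :> algC.
  rewrite big_enum_val /hamming_weight -sum1_card natr_sum big_mkcond /=.
  apply: eq_bigr => i _; rewrite inE mxE.
  by case: eqP => _; rewrite ?subrr ?subr0.
have hz : \sum_(A in X) (\tr (B *m A) == 0)%:R * q =
    #|X|%:R + (q - 1) * fourier 1 (at_most a) B.
  under eq_bigr => A _ do rewrite -sum_psi_mul.
  rewrite exchange_big /= (bigD1 0) //=; congr (_ + _).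
    under eq_bigr => A _ do rewrite mul0r psi0.
    by rewrite sumr_const.
  rewrite fourier_symm_rank_le -/X.
  transitivity (\sum_(c : F | c != 0) \sum_(A in X) psi (\tr (B *m A))).
    apply: eq_bigr => c c0.
    rewrite [RHS](reindex_inj (scalerI c0)) /=.
    apply: eq_big => [A|A _]; last by rewrite -scalemxAr linearZ.
    rewrite !in_symm_rank_le /eps_symm linearZ /= !scale1r eqmx_scale //.
    by rewrite (inj_eq (scalerI c0)).
  rewrite sumr_const -[LHS]mulr_natl; congr (_ * _).
  have -> : q = (#|[pred c : F | c != 0]|.+1)%:R.
    by rewrite (cardC1 0) prednK //; apply/card_gt0P; exists 0.
  by rewrite -addn1 natrD addrK.
rewrite hw big_split /= sumr_const sumrN.
have -> : \sum_(A in X) (\tr (B *m A) == 0)%:R =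
    (#|X|%:R + (q - 1) * fourier 1 (at_most a) B) / q.
  by rewrite -hz -big_distrl /= mulfK.
by field.
Qed.

Lemma sum_mu a m : \sum_(s < a.+1) (mu F s m)%:R = #|symm_rank_le F a m|%:R :> algC.
Proof.
rewrite -natr_sum; congr _%:R; rewrite -sum1_card.
rewrite (partition_big (fun A => inord (\rank A) : 'I_a.+1) xpredT) //=.
apply: eq_bigr => s _; rewrite /mu -sum1_card; apply: eq_bigl => A.
rewrite in_symm_rank_le inE symm_trmx -andbA; congr (_ && _).
apply/eqP/andP => [->|[h /eqP <-]]; last by rewrite inordK.
by rewrite -ltnS ltn_ord inord_val.
Qed.

Lemma in_Omega t M (A : 'M[F]_M) :
  (A \in Omega F M t) = eps_symm (-1) A && (\rank A == t.*2).
Proof.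
rewrite inE qualifE /= expr1 mul2n; congr (_ && _).
rewrite /eps_symm !scaleN1r -(inj_eq oppr_inj) opprK eq_sym; congr (_ == _).
by apply/matrixP=> i j; rewrite !mxE.
Qed.

(** For alternating A and B, Tr(AB) is -2 times the sum of a_ij b_ij over i < j. *)
Lemma krawtchouk_fourier t M (A : 'M[F]_M) : eps_symm (-1) A ->
  \sum_(B in Omega F M t) psi (\sum_(i < M) \sum_(j < M | (i < j)%N) A i j * B i j) =
  fourier (-1) (exactly t.*2) (- 2^-1 *: A).
Proof.
have two_neq0 := odd_card_two_neq0 oddF.
move=> hA; rewrite [RHS]big_mkcond [LHS]big_mkcond; apply: eq_bigr => B _.
rewrite in_Omega.
case hB: (eps_symm (-1) B) => //=; rewrite /exactly.
case: eqP => _; rewrite ?mul0r // mul1r; congr psi.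
have sk (C : 'M[F]_M) : eps_symm (-1) C -> forall i j, C j i = - C i j.
  by move=> /eqP/matrixP h i j; have := h i j; rewrite scaleN1r !mxE.
pose f i j := A i j * B i j.
have fC i j : f i j = f j i by rewrite /f (sk A hA j i) (sk B hB j i) mulrNN.
have trE : \tr (A *m B) = - \sum_i \sum_j f i j.
  rewrite /mxtrace -sumrN; apply: eq_bigr => i _; rewrite mxE -sumrN.
  by apply: eq_bigr => j _; rewrite (sk B hB i j) mulrN.
have f0 i : f i i = 0.
  have /eqP := sk A hA i i; rewrite -subr_eq0 opprK -mulr2n -mulr_natl mulf_eq0.
  by rewrite (negPf two_neq0) /= /f => /eqP ->; rewrite mul0r.
have split2 : \sum_i \sum_j f i j = 2 * \sum_(i < M) \sum_(j < M | (i < j)%N) f i j.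
  rewrite mulr_natl mulr2n.
  have {2}-> : \sum_(i < M) \sum_(j < M | (i < j)%N) f i j =
      \sum_(i < M) \sum_(j < M | (j < i)%N) f i j.
    rewrite (exchange_big_dep xpredT) //=; apply: eq_bigr => i _.
    by apply: eq_bigr => j _; exact: fC.
  rewrite -big_split /=; apply: eq_bigr => i _.
  rewrite (bigID (fun j : 'I_M => i < j)%N) /=; congr (_ + _).
  rewrite (bigD1 i) ?ltnn //= f0 add0r; apply: eq_bigl => j.
  by rewrite -leqNgt ltn_neqAle andbC.
by rewrite -scalemxAl linearZ /= trE split2 mulNr mulrN opprK mulrA mulVf // mul1r.
Qed.

End Weights.

Theorem theorem3p6 (F : finFieldType) (m t : nat) (chi : 'CF([set: F])) :
  odd #|F| -> (0 < m)%N -> (t <= m./2)%N ->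
  chi \is a linear_char -> chi != 1 ->
  let q : algC := #|F|%:R in
  let main : algC := (q - 1) / q * \sum_(s < (2 * t).+1) (mu F s m)%:R in
  (forall (l : nat) (A : 'M[F]_(m - 1)),
     (2 * l + 1 <= m)%N -> A \in Omega F (m - 1) l ->
     is_weight F (2 * t) m (2 * l + 1) 0
       (main - (q - 1) / q * q ^+ (2 * t) * krawtchouk chi t A)) /\
  (forall (l : nat) (tau : int) (A : 'M[F]_(m - 1)),
     (1 <= l)%N -> (2 * l <= m)%N -> (tau = 1 \/ tau = -1) ->
     A \in Omega F (m - 1) (l - 1) ->
     is_weight F (2 * t) m (2 * l) tau
       (main - (q - 1) / q * q ^+ (2 * t) * krawtchouk chi t A)).
Proof.
move=> oddF m0 _ chi_lin chi1.
case: m m0 => // n _; have -> : (n.+1 - 1 = n)%N by rewrite subn1.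
move=> q main.
have chiD (x y : F) : chi (x + y) = chi x * chi y.
  by apply: (lin_charM chi_lin); rewrite inE.
have chi0 : chi 0 = 1 by apply: (lin_char1 chi_lin).
have chi_nt : exists c, chi c != 1.
  apply/existsP; apply: contraNT chi1; rewrite negb_exists => /forallP h.
  apply/eqP/cfun_inP => x _; rewrite cfun1E inE; apply/eqP.
  by move: (h x); rewrite negbK.
have two_neq0 := odd_card_two_neq0 oddF.
(* Scaling A by -1/2 does not change its rank, and the right-hand side of
   symm_fourier_eq_alt_fourier depends on C through its rank alone. *)
have key (B : 'M[F]_n.+1) l (A : 'M[F]_n) : B \in symm F n.+1 -> B != 0 ->
    A \in Omega F n l -> l = ((\rank B).-1)./2 ->
    (hamming_weight (codeword (2 * t) B))%:R =
    main - (q - 1) / q * q ^+ (2 * t) * krawtchouk chi t A.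
  move=> hB B0 hA hl; rewrite (weight_psi chiD chi0 chi_nt) /main sum_mu mulrBr.
  congr (_ - _); rewrite -mulrA; congr (_ * _).
  move: hA; rewrite in_Omega => /andP[hA /eqP rA].
  rewrite /krawtchouk (krawtchouk_fourier _ oddF _ hA).
  rewrite mul2n; apply: symm_fourier_eq_alt_fourier => //; first by rewrite -symm_trmx.
    by move: hA; rewrite /eps_symm linearZ /= => /eqP->; rewrite !scalerA mulrC.
  have i0 : - 2^-1 != 0 :> F by rewrite oppr_eq0 invr_eq0.
  by rewrite mxrank_scale_nz // rA hl.
split=> [l A lm hA|l tau A l1 lm htau hA].
  rewrite !mul2n addn1 in lm *; split; first exact: odd_rank_exists.
  move=> B hB rB _; rewrite -mul2n; apply: key hA _ => //.
    by rewrite -mxrank_eq0 rB.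
  by rewrite rB /= doubleK.
rewrite (mul2n l) in lm *; split; first exact: type_exists.
move=> B hB rB _; apply: key hA _ => //.
  by rewrite -mxrank_eq0 rB; lia.
by rewrite rB; lia.
Qed.
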